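(* Let $k\ge 3$ be an integer. The centered $k$-gonal numbers are the integers $\frac{km(m+1)}{2}+1$ for integers $m\ge 0$. For a positive integer $n$ put $s=\left\lfloor\sqrt{\frac{2n}{k}}\right\rfloor$. Then the $n$-th smallest nonnegative integer that is not a centered $k$-gonal number equals $$a(n)=\begin{cases} n+s & \text{if } 2(n+s-1)>ks(s+1),\\ n+s-1 & \text{otherwise.}\end{cases}$$ (In particular $a(1)=0$.) *)

(* Defs.v *)
From HB Require Import structures.
From mathcomp Require Import all_boot all_order all_algebra.
From mathcomp Require Import boolp classical_sets functions cardinality reals.

Set Implicit Arguments.
Unset Strict Implicit.
Unset Printing Implicit Defensive.

Import Order.TTheory GRing.Theory Num.Theory.

Local Open Scope classical_set_scope.
Local Open Scope ring_scope.

(* k * m * (m + 1) is even, so the natural-number quotient by 2 is exact. *)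
Definition centered_gonal (k : nat) : set int :=
  [set c | exists m : nat, c = Posz ((k * m * (m + 1)) %/ 2 + 1)%N].

Definition non_centered_gonal (k : nat) : set int :=
  [set x | 0 <= x /\ ~ centered_gonal k x].

(* Ranks start at 1: the n-th smallest element x of A is the element of A such
   that exactly n elements of A (x itself included) are at most x. *)
Definition nth_smallest (d : Order.disp_t) (T : orderType d)
    (A : set T) (n : nat) (x : T) : Prop :=
  A x /\ ([set y | A y /\ (y <= x)%O] #= `I_n)%card.

Definition gonal_s (R : realType) (k n : nat) : int :=
  Num.floor (Num.sqrt ((2 * n)%:R / k%:R : R)).

Definition gonal_a (R : realType) (k n : nat) : int :=
  let s := gonal_s R k n in
  if 2 * (n%:Z + s - 1) > k%:Z * s * (s + 1) then n%:Z + s else n%:Z + s - 1.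

(* Main.v *)
(** Write c(m) for the m-th centered k-gonal number.  If c(j-1) < a < c(j), then
    a is not centered k-gonal and exactly j of the a+1 integers 0, ..., a are,
    so a is the non-member of rank a + 1 - j.  Hence the n-th non-member is
    n + j - 1 for the j with c(j-1) < n + j - 1 < c(j).  Since
    k s^2 <= 2n < k (s+1)^2, this j is s or s + 1, and comparing n + s with c(s)
    tells which. *)

Require Import Defs.
From HB Require Import structures.
From mathcomp Require Import all_boot all_order all_algebra.
From mathcomp Require Import boolp classical_sets functions cardinality reals.
From mathcomp Require Import finmap zify.

Import Order.TTheory GRing.Theory Num.Theory.

Local Open Scope classical_set_scope.
Local Open Scope ring_scope.

Lemma card_eq_seq (T : choiceType) (s : seq T) :
  uniq s -> ([set` s] #= `I_(size s))%card.
Proof.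
move=> s_uniq.
have -> : [set` s] = [set` [fset x in s]%fset].
  by apply/seteqP; split=> x /=; rewrite !inE.
by apply/card_eq_fsetP; rewrite card_fseq undup_id.
Qed.

Lemma nth_smallest_complement (c : nat -> nat) (j a : nat) :
  injective c ->
  (forall m, (m < j)%N -> (c m < a)%N) ->
  (forall m, (j <= m)%N -> (a < c m)%N) ->
  nth_smallest [set x : int | 0 <= x /\ ~ exists m, x = Posz (c m)]
    (a.+1 - j) (Posz a).
Proof.
move=> c_inj c_lt c_gt; split=> [/=|].
  split=> // -[m [am]]; case: (ltnP m j) => [/c_lt|/c_gt]; lia.
set s := [seq i <- iota 0 a.+1 | i \notin map c (iota 0 j)].
have -> : (a.+1 - j)%N = size (map Posz s).
  rewrite size_map size_filter.
  (* By injectivity the values of [c] at 0, ..., [j - 1] are distinct, and [c_lt] puts them all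
     below [a]. *)
  have count_c : count (mem (map c (iota 0 j))) (iota 0 a.+1) = j.
    rewrite -size_filter -[RHS](size_iota 0) -(size_map c).
    apply/perm_size/uniq_perm; rewrite ?filter_uniq ?map_inj_uniq ?iota_uniq //.
    move=> x; rewrite mem_filter mem_iota /=; case: mapP => //= -[m].
    by rewrite mem_iota => /c_lt + ->; lia.
  rewrite -[X in (X - _)%N](size_iota 0).
  by rewrite -(count_predC (mem (map c (iota 0 j)))) count_c addKn.
rewrite (_ : [set y | _ /\ _] = [set` map Posz s]).
  by apply: card_eq_seq; rewrite map_inj_uniq ?filter_uniq ?iota_uniq // => ? ? [].
apply/seteqP; split=> [[y|y] [[//= _ cNy] ya]|_ /= /mapP[y + ->]] /=.
  rewrite lez_nat in ya.
  apply/map_f; rewrite mem_filter mem_iota ltnS ya !andbT.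
  by apply/mapP => -[m _ ym]; apply: cNy; exists m; rewrite ym.
rewrite mem_filter mem_iota => /andP[/negP cNy ya].
split; last by rewrite lez_nat -ltnS.
split=> // -[m [ym]]; apply/cNy/mapP; exists m => //; rewrite mem_iota.
by case: (ltnP m j) => // /c_gt; lia.
Qed.

(** One of [m] and [m + 1] is even, so the halving is exact. Doubling removes [%/] from the goals
    left to [lia] and [nia]. *)
Lemma double_centered_gonal (k m : nat) :
  (2 * ((k * m * (m + 1)) %/ 2 + 1) = k * m * (m + 1) + 2)%N.
Proof.
rewrite mulnDr mulnC divnK // dvdn2 -mulnA oddM oddM addn1 /=.
by rewrite andbN andbF.
Qed.

Lemma centered_gonal_inj (k : nat) : (0 < k)%N ->
  injective (fun m => (k * m * (m + 1)) %/ 2 + 1)%N.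
Proof.
move=> k_gt0 x y xy; have := double_centered_gonal k x.
by rewrite xy double_centered_gonal; nia.
Qed.

(** Square the floor inequalities [s <= sqrt (2n / k) < s + 1] and multiply by [k]. *)
Lemma gonal_s_bounds (R : realType) (k n : nat) : (0 < k)%N ->
  exists2 s : nat, gonal_s R k n = Posz s &
    (k * s ^ 2 <= 2 * n < k * s.+1 ^ 2)%N.
Proof.
move=> k_gt0; have kR : 0 < k%:R :> R by rewrite ltr0n.
have q_ge0 : 0 <= (2 * n)%:R / k%:R :> R by rewrite divr_ge0.
rewrite /gonal_s; set q := _ / _ in q_ge0 *.
have : 0 <= Num.floor (Num.sqrt q) by rewrite floor_ge0 sqrtr_ge0.
have := floor_itv (Num.sqrt q).
case: (Num.floor _) => // s /andP[s_le s_gt] _; exists s => //.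
rewrite -(ltr_nat R) -(ler_nat R) ![(k * _)%N]mulnC.
rewrite (natrM _ (s ^ 2)) (natrM _ (s.+1 ^ 2)) !natrX.
rewrite -ler_pdivlMr // -ltr_pdivrMr //.
rewrite -/q -(sqr_sqrtr q_ge0) ler_sqr ?nnegrE ?sqrtr_ge0 //.
rewrite ltr_sqr ?nnegrE ?sqrtr_ge0 //.
by rewrite s_le /= -[s.+1]addn1 natrD; move: s_gt; rewrite intrD.
Qed.

Theorem theorem5 (R : realType) (k : nat) (hk : (3 <= k)%N) :
  (forall n : nat, (0 < n)%N ->
     nth_smallest (non_centered_gonal k) n (gonal_a R k n)) /\
  gonal_a R k 1 = 0.
Proof.
have k_gt0 : (0 < k)%N by lia.
split=> [n n_gt0|]; rewrite /gonal_a; last first.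
  have [s -> /andP[s_le _]] := gonal_s_bounds R k 1 k_gt0.
  (* Here [k * s ^ 2 <= 2 < k]. *)
  have -> : s = 0%N by nia.
  by rewrite mulr0 mul0r.
(* The hypotheses are c(m) < n + j - 1 and n + j - 1 < c(m), doubled. Truncation in [n + j - 2] is
   harmless: [n] is positive, and the first hypothesis is vacuous for [j = 0]. *)
have rank_a (j : nat) :
    (forall m, (m < j)%N -> (k * m * (m + 1) < 2 * (n + j - 2))%N) ->
    (forall m, (j <= m)%N -> (2 * (n + j) < k * m * (m + 1) + 4)%N) ->
    nth_smallest (non_centered_gonal k) n (Posz (n + j - 1)).
  move=> lo hi; have {1}-> : n = ((n + j - 1).+1 - j)%N by lia.
  apply: nth_smallest_complement (centered_gonal_inj k k_gt0) _ _ => m jm.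
    by have := double_centered_gonal k m; have := lo m jm; lia.
  by have := double_centered_gonal k m; have := hi m jm; lia.
have [s -> /andP[s_le s_gt]] := gonal_s_bounds R k n k_gt0.
case: ifP => case_s.
  (* Here j = s + 1: [case_s] says c(s) < n + s, and 2n < k (s+1)^2 gives n + s < c(s+1). *)
  have -> : n%:Z + s%:Z = Posz (n + s.+1 - 1) by lia.
  apply: rank_a => m ms.
    have : (k * m * (m + 1) <= k * s * (s + 1))%N by rewrite !leq_mul //; lia.
    lia.
  have : (k * s.+1 * (s.+1 + 1) <= k * m * (m + 1))%N by rewrite !leq_mul //; lia.
  nia.
have -> : n%:Z + s%:Z - 1 = Posz (n + s - 1) by lia.
apply: rank_a => m ms.
  (* Here j is the old s, now written s + 1. From k (s+1)^2 <= 2n follows k s (s+1) <= 2n - k (s+1),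
     which is below 2 (n + s - 1); at s = 0 this needs k > 2. *)
  case: s => // s in s_le s_gt case_s ms *.
  have : (k * m * (m + 1) <= k * s * (s + 1))%N by rewrite !leq_mul //; lia.
  nia.
have : (k * s * (s + 1) <= k * m * (m + 1))%N by rewrite !leq_mul //; lia.
lia.
Qed.
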